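(* Let $p\ge 1$, let $X\subset\mathbb{P}^r$ be a closed subscheme satisfying property $\mathbf{N}_{2,p}$, and let $\Lambda\subset\mathbb{P}^r$ be a linear subspace of dimension $\le p-1$. If $\dim (X\cap\Lambda)=0$, then the natural restriction map $$H^0(\mathbb{P}^r,\mathcal{I}_X(2))\to H^0(\Lambda,\mathcal{I}_{X\cap\Lambda,\Lambda}(2))$$ is surjective.
   Context: $k$ is an algebraically closed field, $S=k[x_0,\dots,x_r]$ and $\mathbb{P}^r=\operatorname{Proj}S$. For a closed subscheme $X\subset\mathbb{P}^r$, $\mathcal{I}_X$ is its ideal sheaf and $I_X\subset S$ its (saturated) homogeneous ideal; $X$ is nondegenerate if $I_X$ contains no nonzero linear form. For $p\ge 1$, $X$ satisfies $\mathbf{N}_{2,p}$ if $X$ is nondegenerate, $I_X$ is generated by quadrics, and the minimal free resolution of $I_X$ is linear for the first $p$ steps, i.e. $\operatorname{Tor}_i^S(I_X,k)$ is concentrated in degrees $\le i+2$ for all $0\le i\le p-1$. $X\cap\Lambda$ is the scheme-theoretic intersection and $\mathcal{I}_{X\cap\Lambda,\Lambda}\subset\mathcal{O}_\Lambda$ is its ideal sheaf in $\Lambda$. *)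

(* Defs.v *)
From mathcomp Require Import all_boot all_order all_algebra.
From mathcomp Require Import mpoly.

Set Implicit Arguments.
Unset Strict Implicit.
Unset Printing Implicit Defensive.

Import GRing.Theory.
Local Open Scope ring_scope.

Definition is_ideal (A : nzRingType) (I : A -> Prop) : Prop :=
  [/\ I 0,
      forall f g, I f -> I g -> I (f + g)
    & forall a f, I f -> I (a * f)].

Definition ideal_gen (A : nzRingType) (G : A -> Prop) (f : A) : Prop :=
  exists m (c g : 'I_m -> A),
    (forall j, G (g j)) /\ f = \sum_(j < m) c j * g j.

Definition is_prime (A : nzRingType) (P : A -> Prop) : Prop :=
  [/\ is_ideal P, ~ P 1 & forall f g, P (f * g) -> P f \/ P g].

Definition homogeneous (k : nzRingType) (n : nat)
    (I : {mpoly k[n]} -> Prop) : Prop :=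
  forall f, I f -> forall d, I (pihomog mdeg d f).

(* I : m^oo = I, where m is the irrelevant ideal. *)
Definition saturated (k : nzRingType) (n : nat)
    (I : {mpoly k[n]} -> Prop) : Prop :=
  forall f N,
    (forall h : {mpoly k[n]}, h \is N.-homog -> I (h * f)) -> I f.

(* Closed subschemes X of P^r = Proj k[x_0, ..., x_r] correspond bijectively
   to saturated homogeneous ideals, by X |-> I_X. *)
Record closed_subscheme (k : fieldType) (r : nat) := ClosedSubscheme {
  ideal_of :> {mpoly k[r.+1]} -> Prop;
  ideal_of_ideal : is_ideal ideal_of;
  ideal_of_homogeneous : homogeneous ideal_of;
  ideal_of_saturated : saturated ideal_of
}.

(* The scheme Proj (k[y_0, ..., y_n] / J): its points, its Krull dimension
   (irreducible closed subsets are the closures of the points), and the global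
   sections of the twists of the ideal sheaf J~ on P^n.  The homogeneous ideal
   J need not be saturated. *)

Definition proj_point (k : fieldType) (n : nat)
    (J P : {mpoly k[n.+1]} -> Prop) : Prop :=
  [/\ is_prime P, homogeneous P, forall f, J f -> P f
    & exists i : 'I_n.+1, ~ P 'X_i].

Definition proj_dim_ge (k : fieldType) (n : nat)
    (J : {mpoly k[n.+1]} -> Prop) (d : nat) : Prop :=
  exists P : nat -> {mpoly k[n.+1]} -> Prop,
    (forall c, (c <= d)%N -> proj_point J (P c)) /\
    (forall c, (c < d)%N ->
       (forall f, P c f -> P c.+1 f) /\ (exists f, P c.+1 f /\ ~ P c f)).

Definition proj_dim_eq (k : fieldType) (n : nat)
    (J : {mpoly k[n.+1]} -> Prop) (d : nat) : Prop :=
  proj_dim_ge J d /\ ~ proj_dim_ge J d.+1.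

(* H^0(P^n, J~(d)).  As P^n is integral, J~(d) is a subsheaf of the constant
   sheaf Frac k[y_0, ..., y_n]; its sections over D_+(y_i) are the fractions
   g / y_i^m with g in J homogeneous of degree d + m. *)
Definition H0 (k : fieldType) (n : nat) (J : {mpoly k[n.+1]} -> Prop)
    (d : nat) (s : {fraction {mpoly k[n.+1]}}) : Prop :=
  forall i : 'I_n.+1, exists (m : nat) (g : {mpoly k[n.+1]}),
    [/\ J g, g \is (d + m).-homog
      & s * tofrac 'X_i ^+ m = tofrac g].

(* A linear subspace L of P^r of dimension n is the projectivization of the row
   space of A : 'M_(n.+1, r.+1) of full row rank; y |-> y *m A identifies P^n
   with L.  The following is the restriction of forms
   k[x_0, ..., x_r] -> k[y_0, ..., y_n]. *)
Definition restr_form (k : fieldType) (r n : nat) (A : 'M[k]_(n.+1, r.+1))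
    (f : {mpoly k[r.+1]}) : {mpoly k[n.+1]} :=
  f \mPo [tuple \sum_(i < n.+1) A i j *: 'X_i | j < r.+1].

(* The ideal I_X k[y_0, ..., y_n] defining X \cap L in L = P^n; it is the plain
   image of I_X since restr_form A is surjective.  In general it is not
   saturated. *)
Definition inter_ideal (k : fieldType) (r n : nat) (A : 'M[k]_(n.+1, r.+1))
    (X : closed_subscheme k r) (h : {mpoly k[n.+1]}) : Prop :=
  exists2 f, X f & h = restr_form A f.

(* t is the restriction to L of the section s: whenever s = g / x_i^m on
   D_+(x_i), t = g|_L / (x_i|_L)^m on D_+(x_i) \cap L.  A fraction s outside
   H^0 need not have any representation g / x_i^m. *)
Definition restricts_to (k : fieldType) (r n : nat) (A : 'M[k]_(n.+1, r.+1))
    (s : {fraction {mpoly k[r.+1]}}) (t : {fraction {mpoly k[n.+1]}}) : Prop :=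
  forall (i : 'I_r.+1) (m : nat) (g : {mpoly k[r.+1]}),
    s * tofrac 'X_i ^+ m = tofrac g ->
    t * tofrac (restr_form A 'X_i) ^+ m = tofrac (restr_form A g).

(* Graded complexes ... -> F_1 -> F_0 -> S of free modules of finite rank over
   S = k[x_0, ..., x_(n-1)]: F_i is the direct sum over j of the S(- deg i j),
   its elements are row vectors, and matrices act on the right. *)
Record free_complex (k : fieldType) (n : nat) := FreeComplex {
  rk : nat -> nat;
  gdeg : forall i, 'I_(rk i) -> nat;
  augm : 'cV[{mpoly k[n]}]_(rk 0);
  diff : forall i, 'M[{mpoly k[n]}]_(rk i.+1, rk i)
}.

Definition graded_complex (k : fieldType) (n : nat)
    (F : free_complex k n) : Prop :=
  (forall j, augm F j 0 \is (gdeg j).-homog) /\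
  (forall i j l,
     ((gdeg l <= gdeg j)%N -> diff F i j l \is (gdeg j - gdeg l).-homog) /\
     ((gdeg j < gdeg l)%N -> diff F i j l = 0)).

Definition graded_free_resolution (k : fieldType) (n : nat)
    (I : {mpoly k[n]} -> Prop) (F : free_complex k n) : Prop :=
  [/\ graded_complex F,
      forall f, I f <-> exists v : 'rV_(rk F 0), f = (v *m augm F) 0 0,
      forall v : 'rV_(rk F 0),
        v *m augm F = 0 <-> exists w, v = w *m diff F 0
    & forall i (v : 'rV_(rk F i.+1)),
        v *m diff F i = 0 <-> exists w, v = w *m diff F i.+1].

(* F \otimes_S k, with k = S / (x_0, ..., x_(n-1)). *)
Definition diff_k (k : fieldType) (n : nat) (F : free_complex k n) (i : nat) :
    'M[k]_(rk F i.+1, rk F i) :=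
  map_mx (fun f : {mpoly k[n]} => f@_0%MM) (diff F i).

Definition minimal_complex (k : fieldType) (n : nat)
    (F : free_complex k n) : Prop :=
  forall i, diff_k F i = 0.

Definition cycle_k (k : fieldType) (n : nat) (F : free_complex k n) (i : nat) :
    'rV[k]_(rk F i) -> Prop :=
  match i return 'rV[k]_(rk F i) -> Prop with
  | 0 => fun _ => True
  | i'.+1 => fun v => v *m diff_k F i' = 0
  end.

(* H_i(F \otimes_S k) vanishes in degree e; when F is a graded free resolution
   of I, this says Tor_i^S(I, k)_e = 0. *)
Definition Tor_vanishes (k : fieldType) (n : nat) (F : free_complex k n)
    (i e : nat) : Prop :=
  forall v : 'rV[k]_(rk F i),
    (forall j, gdeg j != e -> v 0 j = 0) ->
    cycle_k v -> exists w, v = w *m diff_k F i.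

Definition nondegenerate (k : fieldType) (r : nat)
    (X : closed_subscheme k r) : Prop :=
  forall f, X f -> f \is 1.-homog -> f = 0.

Definition generated_by_quadrics (k : fieldType) (r : nat)
    (X : closed_subscheme k r) : Prop :=
  forall f, X f -> ideal_gen (fun q => X q /\ q \is 2.-homog) f.

Definition N2 (k : fieldType) (r : nat) (p : nat)
    (X : closed_subscheme k r) : Prop :=
  [/\ nondegenerate X, generated_by_quadrics X
    & exists F : free_complex k r.+1,
        [/\ graded_free_resolution X F, minimal_complex F
          & forall i e, (i < p)%N -> (i + 2 < e)%N -> Tor_vanishes F i e]].

(* Main.v *)
Require Import Defs.
From HB Require Import structures.
From mathcomp Require Import all_boot all_order all_algebra.
From mathcomp Require Import mpoly zify.
From Stdlib Require Import ClassicalEpsilon.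

(* Let [T] be the coordinate ring of [L], [J] the ideal of [X \cap L] in [T] and
   [q] a quadric in the saturation of [J]; we must show [q \in J].

   As [X \cap L] is finite, some linear form [l], say [l = y_0], is a parameter:
   [J + (l)] contains a power of the irrelevant ideal, so [J] contains forms
   [f_a = y_a^N - l c_a] for [0 < a <= n].  Put [f_0 = l].  Then [f_0, ..., f_n]
   is a regular sequence generating the monomial ideal
   [(y_0, y_1^N, ..., y_n^N)], which contains every form of degree
   [> n (N - 1)].  It is enough to show that [l q \in J] implies [q \in J] for
   forms [q] of degree [>= 2], and to apply this repeatedly to [l^M q \in J].

   Let [G] be the resolution of [S / I_X] restricted to [L].  It is not exact, but
   multiplication by [f_a] on [G] is null-homotopic for [a > 0], because
   [f_a] lifts to [I_X].  Write [l q = d z_1] with [z_1 \in G_1].  Modulo [f_0],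
   [z_1] is a cycle, so [f_1 z_1] bounds some [z_2 \in G_2], which is a cycle
   modulo [f_0, f_1], and so on, up to [z_(n+1) \in G_(n+1)].  By linearity of the
   syzygies the coefficients of [z_(n+1)] have degree [> n (N - 1)], so that
   [z_(n+1) = 0] modulo [f_0, ..., f_n].  As the sequence is regular, going
   back down cancels the [f_a] one by one, and shows that [q] is a boundary. *)

Set Implicit Arguments.
Unset Strict Implicit.
Unset Printing Implicit Defensive.

Import Order.TTheory GRing.Theory.
Local Open Scope ring_scope.

(** * Graded pieces *)

Section Ideals.
Variables (A : nzRingType) (I : A -> Prop).
Hypothesis idI : is_ideal I.

Lemma ideal0 : I 0. Proof. by case: idI. Qed.
Lemma idealD f g : I f -> I g -> I (f + g). Proof. by case: idI => _ + _; apply. Qed.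
Lemma idealMl a f : I f -> I (a * f). Proof. by case: idI => _ _; apply. Qed.
Lemma idealN f : I f -> I (- f). Proof. by rewrite -mulN1r; apply: idealMl. Qed.
Lemma idealB f g : I f -> I g -> I (f - g).
Proof. by move=> If Ig; apply/idealD/idealN. Qed.

Lemma ideal_sum (J : Type) (r : seq J) (P : pred J) (F : J -> A) :
  (forall j, P j -> I (F j)) -> I (\sum_(j <- r | P j) F j).
Proof. by move=> IF; elim/big_ind: _ => //; [exact: ideal0 | exact: idealD]. Qed.

End Ideals.

Section Homog.
Variables (k : fieldType) (n : nat).
Implicit Types (p q f : {mpoly k[n]}) (m : 'X_{1..n}).

Lemma mcoeff_pihomog d p m :
  (pihomog mdeg d p)@_m = if mdeg m == d then p@_m else 0.
Proof.
rewrite /pihomog raddf_sum /= -big_filter.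
have -> : \sum_(i <- [seq i <- msupp p | mdeg i == d]) (p@_i *: 'X_[i])@_m
        = \sum_(i <- [seq i <- msupp p | mdeg i == d]) if i == m then p@_m else 0.
  by apply: eq_bigr => i _; rewrite mcoeffZ mcoeffX; case: eqP => [->|]; rewrite ?mulr1 ?mulr0.
rewrite -big_mkcond /= -big_filter.
case: ifP => dm; last first.
  rewrite big1_seq // => i /andP[_].
  by rewrite !mem_filter => /and3P[/eqP->]; rewrite dm.
have [mp|mp] := boolP (m \in msupp p); last first.
  by rewrite (memN_msupp_eq0 mp) big1.
rewrite (perm_big [:: m]) ?big_seq1 //.
apply: uniq_perm; rewrite ?filter_uniq ?msupp_uniq // => i.
by rewrite !mem_filter inE; case: eqP => // ->; rewrite dm mp.
Qed.

(** Homogeneity of degree [b - a], as for a matrix entry between generators of degrees [a] and [b].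
    The additive form forces [p = 0] when [b < a]. *)
Definition shomog (a b : nat) p := forall m, m \in msupp p -> (mdeg m + a = b)%N.

Definition hcomp (a b : nat) p :=
  if (a <= b)%N then pihomog mdeg (b - a)%N p else 0.

Lemma mcoeff_hcomp a b p m :
  (hcomp a b p)@_m = if (mdeg m + a == b)%N then p@_m else 0.
Proof.
rewrite /hcomp; case: leqP => [ab|ba]; rewrite ?mcoeff_pihomog ?mcoeff0.
  by rewrite -(eqn_add2r a) subnK.
by case: eqP => // e; move: ba; rewrite -e ltnNge leq_addl.
Qed.

Lemma hcompP a b p : shomog a b (hcomp a b p).
Proof.
move=> m; rewrite mcoeff_msupp mcoeff_hcomp; by case: ifP => [/eqP//|]; rewrite eqxx.
Qed.

Lemma hcomp_id a b p : shomog a b p -> hcomp a b p = p.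
Proof.
move=> hp; apply/mpolyP=> m; rewrite mcoeff_hcomp.
have [/hp->|/memN_msupp_eq0->] := boolP (m \in msupp p); by rewrite ?eqxx ?if_same.
Qed.

Lemma hcompD a b : {morph hcomp a b : p q / p + q}.
Proof.
move=> p q; apply/mpolyP=> m.
by rewrite mcoeffD !mcoeff_hcomp mcoeffD; case: ifP; rewrite ?addr0.
Qed.

Lemma hcompN a b : {morph hcomp a b : p / - p}.
Proof.
move=> p; apply/mpolyP=> m.
by rewrite mcoeffN !mcoeff_hcomp mcoeffN; case: ifP; rewrite ?oppr0.
Qed.

Lemma hcomp0 a b : hcomp a b 0 = 0.
Proof. by apply: (addIr (hcomp a b 0)); rewrite -hcompD !add0r. Qed.

Lemma hcomp_sum a b (J : Type) (r : seq J) (P : pred J) F :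
  hcomp a b (\sum_(j <- r | P j) F j) = \sum_(j <- r | P j) hcomp a b (F j).
Proof. exact: (big_morph _ (hcompD a b) (hcomp0 a b)). Qed.

Lemma shomogM a b e p q : shomog b e q -> shomog a b p -> shomog a e (q * p).
Proof.
move=> hq hp m /msuppM_le /allpairsP[[m1 m2] /= [m1q m2p ->]].
by rewrite mdegD -addnA (hp _ m2p) (hq _ m1q).
Qed.

Lemma hcompM a b e p q :
  shomog a b p -> hcomp a e (q * p) = hcomp b e q * p.
Proof.
move=> hp; rewrite -{1}(subrK (hcomp b e q) q) mulrDl hcompD addrC.
rewrite (hcomp_id (shomogM (@hcompP b e q) hp)).
suff -> : hcomp a e ((q - hcomp b e q) * p) = 0 by rewrite addr0.
apply/mpolyP=> m; rewrite mcoeff_hcomp mcoeff0; case: eqP => // me.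
apply/eqP; rewrite mcoeff_eq0; apply/negP.
move=> /msuppM_le /allpairsP[[m1 m2] /= [m1q m2p mE]].
move: m1q; rewrite mcoeff_msupp mcoeffB mcoeff_hcomp.
by rewrite -(hp _ m2p) -me mE mdegD -addnA eqxx subrr eqxx.
Qed.

Lemma shomogE a b p :
  ((a <= b)%N -> p \is (b - a).-homog) -> ((b < a)%N -> p = 0) -> shomog a b p.
Proof.
move=> h1 h2 m mp; case: (leqP a b) => [ab|/h2 p0].
  by move/dhomogP: (h1 ab) => /(_ _ mp) ->; rewrite subnK.
by move: mp; rewrite p0 msupp0.
Qed.

Lemma shomog_dhomog a b p : (a <= b)%N -> shomog a b p -> p \is (b - a).-homog.
Proof. by move=> ab hp; apply/dhomogP => m /hp <-; rewrite addnK. Qed.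

Lemma dhomog_shomog a d p : p \is d.-homog -> shomog a (d + a)%N p.
Proof. by move=> /dhomogP hp m /hp ->. Qed.

Lemma dhomog_exp p N : p \is 1.-homog -> p ^+ N \is N.-homog.
Proof. by move=> hp; have := dhomogMn N hp; rewrite mul1n. Qed.

Lemma dhomog_var (i : 'I_n) : ('X_i : {mpoly k[n]}) \is 1.-homog.
Proof. by rewrite dhomogX /= mdeg1. Qed.

Lemma pihomog_hcomp d p : pihomog mdeg d p = hcomp 0 d p.
Proof. by rewrite /hcomp subn0. Qed.

Lemma homogeneous_hcomp (I : {mpoly k[n]} -> Prop) a b p :
  is_ideal I -> homogeneous I -> I p -> I (hcomp a b p).
Proof.
by move=> idI hI Ip; rewrite /hcomp; case: ifP => _; [exact: hI | exact: ideal0].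
Qed.

End Homog.

(** * Cancelling a regular sequence *)

Section Chase.
Variables (k : fieldType) (m n N : nat).
Local Notation T := {mpoly k[m]}.
Variables (rk : nat -> nat) (gd : forall i, 'I_(rk i) -> nat).
Variable d : forall i, 'M[T]_(rk i.+1, rk i).
Arguments gd {i}.
Hypothesis d_homog : forall i j l, shomog (gd l) (gd j) (d i j l).
Hypothesis d2 : forall i, d i.+1 *m d i = 0.
(** [Q a] abstracts the ideal generated by the [f b] with [b < a]: [Q_incr], [Q_f] and [Q_split] say
    that [Q a.+1] is [Q a] plus the multiples of [f a], and [Q_reg] that the sequence is regular. *)
Variables (f : nat -> T) (Q : nat -> T -> Prop).
Hypothesis Q_ideal : forall a, is_ideal (Q a).
Hypothesis Q_homog : forall a, homogeneous (Q a).
Hypothesis Q0 : forall h, Q 0 h -> h = 0.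
Hypothesis Q_incr : forall a h, Q a h -> Q a.+1 h.
Hypothesis Q_f : forall a, (a <= n)%N -> Q a.+1 (f a).
Hypothesis Q_split : forall a h, (a <= n)%N -> Q a.+1 h -> exists v, Q a (h - f a * v).
Hypothesis Q_reg : forall a h, (a <= n)%N -> Q a (f a * h) -> Q a h.
Hypothesis f_homog : forall a, (a < n)%N -> f a.+1 \is N.-homog.
Variable s : nat -> forall i, 'M[T]_(rk i, rk i.+1).
Hypothesis ds : forall a i, (a < n)%N ->
  s a.+1 i.+1 *m d i.+1 + d i *m s a.+1 i = (f a.+1)%:M.

Definition inQ a r (z : 'rV[T]_r) := forall j, Q a (z 0 j).

Lemma inQD a r (y z : 'rV[T]_r) : inQ a y -> inQ a z -> inQ a (y + z).
Proof. by move=> Qy Qz j; rewrite mxE; apply: idealD. Qed.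

Lemma inQN a r (z : 'rV[T]_r) : inQ a z -> inQ a (- z).
Proof. by move=> Qz j; rewrite mxE; apply: idealN. Qed.

Lemma inQM a r r' (z : 'rV[T]_r) (B : 'M_(r, r')) : inQ a z -> inQ a (z *m B).
Proof.
by move=> Qz j; rewrite mxE; apply: ideal_sum => // i _; rewrite mulrC; apply: idealMl.
Qed.

Definition vhomog i e (z : 'rV[T]_(rk i)) := forall j, shomog (gd j) e (z 0 j).

Definition vcomp i e (z : 'rV[T]_(rk i)) : 'rV[T]_(rk i) :=
  \row_j hcomp (gd j) e (z 0 j).

Lemma vcompP i e (z : 'rV_(rk i)) : vhomog e (vcomp e z).
Proof. by move=> j; rewrite mxE; apply: hcompP. Qed.

Lemma vcomp_id i e (z : 'rV_(rk i)) : vhomog e z -> vcomp e z = z.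
Proof. by move=> hz; apply/rowP=> j; rewrite mxE hcomp_id. Qed.

Lemma vcompB i e (y z : 'rV_(rk i)) : vcomp e (y - z) = vcomp e y - vcomp e z.
Proof. by apply/rowP=> j; rewrite !mxE hcompD hcompN. Qed.

Lemma vcompM i e (z : 'rV_(rk i.+1)) : vcomp e (z *m d i) = vcomp e z *m d i.
Proof.
apply/rowP=> l; rewrite !mxE hcomp_sum; apply: eq_bigr => j _.
by rewrite mxE; apply: hcompM.
Qed.

Lemma vcompQ a i e (z : 'rV_(rk i)) : inQ a z -> inQ a (vcomp e z).
Proof. by move=> Qz j; rewrite mxE; apply: homogeneous_hcomp. Qed.

(* If [f_a z] is a boundary [z' d] modulo [Q_a] and [z'] is a boundary modulo
   [Q_(a+1) = Q_a + (f_a)], then cancelling [f_a] makes [z] a boundary. *)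
Lemma chase_step a (z : 'rV_(rk a)) (z' : 'rV_(rk a.+1)) (w' : 'rV_(rk a.+2)) :
  (a <= n)%N -> inQ a (z' *m d a - f a *: z) -> inQ a.+1 (z' - w' *m d a.+1) ->
  exists v : 'rV_(rk a.+1), inQ a (z - v *m d a).
Proof.
move=> an Qz' Qw'.
have /fin_all_exists[v Qv] j := Q_split an (Qw' j).
pose y := z' - w' *m d a.+1 - f a *: \row_j v j.
have Qy : inQ a y by move=> j; move: (Qv j); rewrite !mxE.
exists (\row_j v j) => j; apply: Q_reg => //.
suff : inQ a (f a *: (z - (\row_j v j) *m d a)) by move/(_ j); rewrite mxE.
have -> : f a *: (z - (\row_j v j) *m d a)
        = y *m d a - (z' *m d a - f a *: z).
  rewrite /y !mulmxBl -mulmxA d2 mulmx0 subr0 -scalemxAl scalerBr opprB.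
  by rewrite [RHS]addrCA addrAC subrr add0r.
by apply: inQD; [exact: inQM | exact: inQN].
Qed.

(** Induction on [n - a]. Each homotopy raises the position by one and the degree by [N], so the
    chain ends at position [n.+1] in degree [e + n * N], where [top] applies. *)
Lemma chase (e a : nat) (z : 'rV_(rk a.+1)) :
  (forall (j : 'I_(rk n.+1)) h,
     shomog (gd j) (e + n * N)%N h -> Q n.+1 h) ->
  (a <= n)%N -> vhomog (e + a * N)%N z -> inQ a.+1 (z *m d a) ->
  exists w : 'rV_(rk a.+2), inQ a.+1 (z - w *m d a.+1).
Proof.
move=> top; have [b] := ubnP (n - a)%N.
elim: b => // b IH in a z *; rewrite ltnS => nab an hz Qz.
have [na|an'] := leqP n a.
  have en : a = n by apply/eqP; rewrite eqn_leq an.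
  by subst a; exists 0 => j; rewrite mul0mx subr0; apply: (top j).
(* Modulo [Q a.+1], where [z] is a cycle, the homotopy gives a [z'] with boundary [f a.+1 *: z]. As
   [s] need not be homogeneous, only the component of the right degree is kept. *)
pose z' := vcomp (e + a.+1 * N)%N (z *m s a.+1 a.+1).
have Ez' : z' *m d a.+1
         = f a.+1 *: z - vcomp (e + a.+1 * N)%N (z *m d a *m s a.+1 a).
  rewrite -vcompM -mulmxA.
  rewrite (_ : s _ _ *m d _ = (f a.+1)%:M - d a *m s a.+1 a); last first.
    by rewrite -(ds a an') addrK.
  rewrite mulmxBr mulmxA vcompB mul_mx_scalar; congr (_ - _).
  apply: vcomp_id => j; rewrite mxE mulSn addnCA.
  apply: shomogM (hz j); exact/dhomog_shomog/f_homog.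
have Qz' : inQ a.+1 (z' *m d a.+1 - f a.+1 *: z).
  by rewrite Ez' addrAC subrr add0r; apply/inQN/vcompQ/inQM.
have [|| |w' Qw'] := IH a.+1 z' _ an'.
- by apply: leq_trans nab; rewrite ltn_sub2l.
- exact: vcompP.
- rewrite -(subrK (f a.+1 *: z) (z' *m _)); apply: inQD => j; first exact/Q_incr/Qz'.
  by rewrite mxE mulrC; apply: idealMl => //; apply: Q_f.
exact: chase_step an' Qz' Qw'.
Qed.

(** [Q 0] is zero, so at the bottom a boundary modulo [Q 0] is a true boundary. *)
Lemma chase0 (e : nat) (q : 'rV[T]_(rk 0)) (u : 'rV[T]_(rk 1)) :
  (forall (j : 'I_(rk n.+1)) h,
     shomog (gd j) (e + n * N)%N h -> Q n.+1 h) ->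
  vhomog e (f 0 *: q) -> f 0 *: q = u *m d 0 ->
  exists v : 'rV_(rk 1), q = v *m d 0.
Proof.
move=> top hq Eq.
have Eu : vcomp e u *m d 0 = f 0 *: q by rewrite -vcompM -Eq vcomp_id.
have [|| w Qw] := @chase e 0 (vcomp e u) top (leq0n n).
- by rewrite mul0n addn0; apply: vcompP.
- by rewrite Eu => j; rewrite mxE mulrC; apply: idealMl => //; apply: Q_f.
have [|v Qv] := @chase_step 0 q (vcomp e u) w isT _ Qw.
  by rewrite Eu subrr => j; rewrite mxE; apply: ideal0.
by exists v; apply/eqP; rewrite -subr_eq0; apply/eqP/rowP => j; rewrite (Q0 (Qv j)) mxE.
Qed.

End Chase.

(** * Monomial ideals and a regular sequence *)

Section MonomialIdeals.
Variables (k : fieldType) (n : nat) (E : 'I_n -> nat).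
Local Notation T := {mpoly k[n]}.

(* The ideal generated by the powers ['X_i ^+ E i], for [i < a]. *)
Definition monoideal (a : nat) (h : T) : Prop :=
  forall m, m \in msupp h -> exists2 i : 'I_n, (i < a)%N & (E i <= m i)%N.

Lemma monoideal_ideal a : is_ideal (monoideal a).
Proof.
split=> [m|f g Qf Qg m|b f Qf m]; first by rewrite msupp0.
  by move/msuppD_le; rewrite mem_cat => /orP[/Qf|/Qg].
case/msuppM_le/allpairsP=> -[m1 m2] /= [_ /Qf[i ia Ei] ->].
by exists i; rewrite // mnmDE (leq_trans Ei) // leq_addl.
Qed.

Lemma monoideal_homog a : homogeneous (monoideal a).
Proof.
move=> f Qf d m; rewrite mcoeff_msupp mcoeff_pihomog.
by case: ifP; rewrite ?eqxx // -mcoeff_msupp => _ /Qf.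
Qed.

Lemma monoideal0 h : monoideal 0 h -> h = 0.
Proof.
move=> Qh; apply/mpolyP=> m; rewrite mcoeff0; apply/eqP.
by rewrite mcoeff_eq0; apply/negP => /Qh[].
Qed.

Lemma monoidealS a h : monoideal a h -> monoideal a.+1 h.
Proof. by move=> Qh m /Qh[i ia Ei]; exists i => //; apply: ltnW. Qed.

Lemma monoidealX a (i : 'I_n) : (i < a)%N -> monoideal a ('X_i ^+ E i).
Proof.
move=> ia m; rewrite mpolyXn msuppX inE => /eqP->; exists i => //.
by rewrite mulmnE mnm1E eqxx mul1n.
Qed.

(** Monomials divisible by a generator of index below [a] already lie in [monoideal a]; the others
    are divisible by ['X_i ^+ E i]. *)
Lemma monoideal_split a (h : T) (i : 'I_n) : i = a :> nat ->
  monoideal a.+1 h -> exists v, monoideal a (h - 'X_i ^+ E i * v).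
Proof.
move=> ia Qh; rewrite (mpolyE h) big_seq.
elim/big_ind: _ => [|x y [v Qv] [w Qw]|m /Qh[j ja Ej]].
- by exists 0; rewrite mulr0 subr0; apply: ideal0 (monoideal_ideal _).
- exists (v + w); rewrite mulrDr opprD addrACA; by apply: (idealD (monoideal_ideal _)).
move: ja; rewrite ltnS leq_eqVlt => /orP[/eqP ja|ja]; last first.
  exists 0; rewrite mulr0 subr0 => m' /msuppZ_le; rewrite msuppX inE => /eqP->.
  by exists j.
have -> : 'X_[m] = 'X_i ^+ E i * 'X_[m - U_(i) *+ E i] :> T.
  rewrite mpolyXn -mpolyXD addmC submK //; apply/mnm_lepP => l.
  rewrite mulmnE mnm1E; case: eqP => [<-|_]; last by rewrite mul0n.
  by rewrite mul1n (_ : i = j) //; apply: val_inj; rewrite /= ja.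
exists (h@_m *: 'X_[m - U_(i) *+ E i]).
by rewrite -scalerAr subrr; exact: (ideal0 (monoideal_ideal _)).
Qed.

(** Multiplying by a power of the variable of index [a] leaves the exponents of the earlier
    variables unchanged. *)
Lemma monoideal_reg a (h : T) (i : 'I_n) : i = a :> nat ->
  monoideal a ('X_i ^+ E i * h) -> monoideal a h.
Proof.
move=> ia Qh m mh; have [|j ja Ej] := Qh (m + U_(i) *+ E i)%MM.
  by rewrite mpolyXn mulrC mcoeff_msupp addmC mcoeffMX -mcoeff_msupp.
exists j; rewrite // (leq_trans Ej) // mnmDE mulmnE mnm1E.
case: eqP => [ij|_]; last by rewrite mul0n addn0.
by move: ja; rewrite -ij ia ltnn.
Qed.

End MonomialIdeals.
Arguments monoideal_ideal {k n E a}.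

(** The bound means degree above [n * (N - 1)], written without truncated subtraction. *)
Lemma pigeon_mdeg n N (m : 'X_{1..n.+1}) : (0 < N)%N ->
  (n * N < mdeg m + n)%N -> (0 < m ord0)%N \/ exists2 i, i != ord0 & (N <= m i)%N.
Proof.
move=> N0; rewrite mdegE big_ord_recl => lt.
have [m0|m0] := posnP (m ord0); last by left.
right; have [/existsP[i Ni]|] := boolP [exists i : 'I_n, N <= m (lift ord0 i)]%N.
  by exists (lift ord0 i).
rewrite negb_exists => /forallP ltN.
suff : (\sum_(i < n) m (lift ord0 i) + n <= n * N)%N by move: lt; rewrite m0; lia.
rewrite -[in X in (_ + X)%N](card_ord n) -sum1_card -big_split /=.
rewrite -[in leqRHS](card_ord n) -sum_nat_const; apply: leq_sum => i _.
by move: (ltN i); rewrite -ltnNge addn1.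
Qed.

Section RegularSequence.
Variables (k : fieldType) (n N : nat).
Local Notation T := {mpoly k[n.+1]}.
Hypothesis N_gt0 : (0 < N)%N.
Variable c : 'I_n.+1 -> T.

Definition expo (i : 'I_n.+1) := if i == ord0 then 1%N else N.

Definition param (a : nat) : T :=
  if a is 0 then 'X_ord0 else 'X_(inord a) ^+ N - 'X_ord0 * c (inord a).

Let Q := @monoideal k n.+1 expo.

Lemma monoideal_X0 a h : (0 < a)%N -> Q a ('X_ord0 * h).
Proof.
move=> a0; rewrite mulrC; apply: (idealMl monoideal_ideal).
move=> m; rewrite msuppX inE => /eqP->; exists ord0 => //.
by rewrite /expo eqxx mnm1E eqxx.
Qed.

(** Modulo ['X_ord0], which lies in [Q a] once [a > 0], the form [param a] is a pure power.
    Splitting and regularity thus transfer from the monomial generators to [param]. *)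
Lemma param_expo a : (a <= n)%N -> exists2 i : 'I_n.+1, i = a :> nat &
  forall h, Q a ('X_i ^+ expo i * h - param a * h).
Proof.
case: a => [_|a an].
  exists ord0 => // h; rewrite /expo eqxx expr1 subrr.
  exact: (ideal0 monoideal_ideal).
exists (inord a.+1) => [|h]; first by rewrite inordK.
have -> : expo (inord a.+1) = N by rewrite /expo -val_eqE /= inordK.
by rewrite -mulrBl opprB addrC addrNK -mulrA; apply: monoideal_X0.
Qed.

Lemma param_in a : (a <= n)%N -> Q a.+1 (param a).
Proof.
case/param_expo=> i ia /(_ 1); rewrite !mulr1 => /monoidealS Qi.
have /idealB/(_ Qi) : Q a.+1 ('X_i ^+ expo i) by apply: monoidealX; rewrite ia.
by rewrite subKr; apply; apply: monoideal_ideal.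
Qed.

Lemma param_split a h : (a <= n)%N -> Q a.+1 h -> exists v, Q a (h - param a * v).
Proof.
case/param_expo=> i ia Qi /(monoideal_split ia)[v Qv]; exists v.
have := idealD monoideal_ideal Qv (Qi v).
by rewrite addrA subrK.
Qed.

Lemma param_reg a h : (a <= n)%N -> Q a (param a * h) -> Q a h.
Proof.
case/param_expo=> i ia Qi Qh; apply: (monoideal_reg ia).
have := idealD monoideal_ideal (Qi h) Qh.
by rewrite subrK.
Qed.

Lemma monoideal_top a b h : (n * N < b + n - a)%N -> shomog a b h -> Q n.+1 h.
Proof.
move=> lt hh m /hh mE; have [||m0|[i i0 Ni]] := @pigeon_mdeg n N m => //.
- by move: lt; rewrite -mE; lia.
- by exists ord0.
by exists i; rewrite // /expo (negPf i0).
Qed.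

End RegularSequence.

(** * Restriction of forms *)

HB.instance Definition _ (k : fieldType) (r n : nat) (A : 'M[k]_(n.+1, r.+1)) :=
  GRing.RMorphism.copy (restr_form A)
    (comp_mpoly [tuple \sum_(i < n.+1) A i j *: 'X_i | j < r.+1]).
HB.instance Definition _ (k : fieldType) (r n : nat) (A : 'M[k]_(n.+1, r.+1)) :=
  GRing.Linear.copy (restr_form A)
    (comp_mpoly [tuple \sum_(i < n.+1) A i j *: 'X_i | j < r.+1]).

Section RestrForm.
Variables (k : fieldType).

Lemma restr_formX r n (A : 'M[k]_(n.+1, r.+1)) j :
  restr_form A 'X_j = \sum_(i < n.+1) A i j *: 'X_i.
Proof. by rewrite /restr_form comp_mpolyXU -tnth_nth tnth_mktuple. Qed.

Lemma restr_formXm r n (A : 'M[k]_(n.+1, r.+1)) m :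
  restr_form A 'X_[m] = \prod_(i < r.+1) (restr_form A 'X_i) ^+ m i.
Proof. by rewrite mpolyXE_id rmorph_prod; apply: eq_bigr => i _; rewrite rmorphXn. Qed.

Lemma restr_formX_homog r n (A : 'M[k]_(n.+1, r.+1)) m :
  restr_form A 'X_[m] \is (mdeg m).-homog.
Proof.
rewrite restr_formXm mdegE.
elim/big_rec2: _ => [|i p d _ hp]; first exact: dhomog1.
apply: dhomogM => //; apply: dhomog_exp; rewrite restr_formX.
by apply: rpred_sum => j _; apply/rpredZ/dhomog_var.
Qed.

Lemma pihomog_restr_form r n (A : 'M[k]_(n.+1, r.+1)) d p :
  pihomog mdeg d (restr_form A p) = restr_form A (pihomog mdeg d p).
Proof.
rewrite [pihomog _ _ p]pihomogE (linear_sum (restr_form A)) [RHS]big_mkcond /=.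
rewrite {1}(mpolyE p) (linear_sum (restr_form A)) (linear_sum (pihomog mdeg d)).
apply: eq_bigr => m _; rewrite !linearZ /=.
have hm := restr_formX_homog A m.
case: (eqVneq (mdeg m) d) => [<-|ne]; first by rewrite pihomog_dE.
by rewrite (pihomog_ne0 ne hm) scaler0.
Qed.

Lemma restr_form_homog r n (A : 'M[k]_(n.+1, r.+1)) d p :
  p \is d.-homog -> restr_form A p \is d.-homog.
Proof. by move=> /pihomog_dE <-; rewrite -pihomog_restr_form pihomogP. Qed.

Lemma restr_formM r n l (B : 'M[k]_(l.+1, n.+1)) (A : 'M[k]_(n.+1, r.+1)) p :
  restr_form (B *m A) p = restr_form B (restr_form A p).
Proof.
have EX i : restr_form (B *m A) 'X_i = restr_form B (restr_form A 'X_i).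
  rewrite !restr_formX (linear_sum (restr_form B)).
  under [RHS]eq_bigr do rewrite linearZ /= restr_formX scaler_sumr.
  rewrite [RHS]exchange_big; apply: eq_bigr => j _.
  rewrite mxE scaler_suml; apply: eq_bigr => h _.
  by rewrite scalerA mulrC.
rewrite (mpolyE p) (linear_sum (restr_form (B *m A))).
rewrite (linear_sum (restr_form A)) (linear_sum (restr_form B)); apply: eq_bigr => m _.
rewrite !linearZ /=; congr (_ *: _).
rewrite !restr_formXm rmorph_prod; apply: eq_bigr => i _.
by rewrite rmorphXn EX.
Qed.

Lemma restr_form1 n p : restr_form (1%:M : 'M[k]_n.+1) p = p.
Proof.
rewrite /restr_form -[RHS]comp_mpoly_id; congr (_ \mPo _).
apply: eq_mktuple => j; rewrite (bigD1 j) //= mxE eqxx scale1r big1 ?addr0 // => i ij.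
by rewrite mxE (negPf ij) scale0r.
Qed.

Lemma restr_form_surj r n (A : 'M[k]_(n.+1, r.+1)) h : row_free A ->
  exists f, restr_form A f = h.
Proof.
case/row_freeP=> B AB; exists (restr_form B h).
by rewrite -restr_formM AB restr_form1.
Qed.

Variables (r n : nat) (X : closed_subscheme k r).

Lemma inter_ideal_ideal (A : 'M[k]_(n.+1, r.+1)) :
  row_free A -> is_ideal (inter_ideal A X).
Proof.
move=> fA; have idX := ideal_of_ideal X; split.
- by exists 0; rewrite ?raddf0 //; apply: ideal0.
- move=> _ _ [f Xf ->] [g Xg ->]; exists (f + g); rewrite ?raddfD //.
  exact: idealD.
- move=> a _ [f Xf ->]; have [b <-] := restr_form_surj a fA.
  by exists (b * f); rewrite ?rmorphM //; apply: idealMl.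
Qed.

Lemma inter_ideal_homog (A : 'M[k]_(n.+1, r.+1)) : homogeneous (inter_ideal A X).
Proof.
move=> _ [f Xf ->] d; rewrite pihomog_restr_form.
by exists (pihomog mdeg d f) => //; apply: ideal_of_homogeneous.
Qed.

Lemma inter_idealM (B : 'M[k]_n.+1) (A : 'M[k]_(n.+1, r.+1)) h :
  inter_ideal A X h -> inter_ideal (B *m A) X (restr_form B h).
Proof. by case=> f Xf ->; exists f; rewrite // restr_formM. Qed.

End RestrForm.

(** * Homotopies on the resolution *)

Section Resolution.
Variables (k : fieldType) (r : nat) (I : {mpoly k[r]} -> Prop).
Variable F : free_complex k r.
Hypothesis resF : graded_free_resolution I F.

(* The resolution [... -> F_1 -> F_0 -> S] of [S / I], with [S] in position 0. *)
Definition ark i := if i is i'.+1 then rk F i' else 1%N.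

Definition agdeg i : 'I_(ark i) -> nat :=
  match i with 0 => fun _ => 0%N | i'.+1 => @gdeg _ _ F i' end.

Definition adiff i : 'M[{mpoly k[r]}]_(ark i.+1, ark i) :=
  match i with 0 => augm F | i'.+1 => diff F i' end.

Lemma adiff_homog i j l : shomog (agdeg l) (agdeg j) (adiff i j l).
Proof.
case: resF => -[haug hdiff] _ _ _; case: i j l => [|i] j l.
  rewrite ord1 => m mj /=; rewrite addn0.
  exact: (dhomogP _ _ _ (haug j)).
by have [h1 h2] := hdiff i j l; apply: shomogE.
Qed.

Lemma adiff_exact i (v : 'rV_(ark i.+1)) :
  v *m adiff i = 0 <-> exists w, v = w *m adiff i.+1.
Proof. by case: resF => _ _ h0 hS; case: i v => [|i] v; [exact: h0 | exact: hS]. Qed.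

Lemma adiff2 i : adiff i.+1 *m adiff i = 0.
Proof.
apply/row_matrixP=> j; rewrite row_mul row0; apply/adiff_exact.
by exists (delta_mx 0 j); rewrite -rowE.
Qed.

Lemma adiff_lift i l (M : 'M_(l, ark i.+1)) :
  M *m adiff i = 0 -> exists W, M = W *m adiff i.+1.
Proof.
move=> M0; have /fin_all_exists[w Ew] j : exists w, row j M = w *m adiff i.+1.
  by apply/adiff_exact; rewrite -row_mul M0 row0.
exists (\matrix_j w j); apply/row_matrixP=> j.
by rewrite row_mul rowK Ew.
Qed.

(** A null-homotopy of multiplication by [f] on the resolution of [S / I], chosen recursively
    because each matrix must fit the preceding one. *)
Fixpoint homotopy (f : {mpoly k[r]}) i : 'M[{mpoly k[r]}]_(ark i, ark i.+1) :=
  match i return 'M[{mpoly k[r]}]_(ark i, ark i.+1) with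
  | 0 => epsilon (inhabits 0) (fun M => M *m adiff 0 = f%:M)
  | i'.+1 => epsilon (inhabits 0)
      (fun M => M *m adiff i'.+1 = f%:M - adiff i' *m homotopy f i')
  end.

Lemma homotopyP f i : I f ->
  homotopy f i.+1 *m adiff i.+1 + adiff i *m homotopy f i = f%:M.
Proof.
move=> If; apply: (canLR (subrK _)) => /=.
elim: i => [|i IH].
  apply: (epsilon_spec (inhabits 0) (fun M => M *m adiff 1 = f%:M - adiff 0 *m _)).
  have E0 : homotopy f 0 *m adiff 0 = f%:M.
    apply: (epsilon_spec (inhabits 0) (fun M => M *m adiff 0 = f%:M)).
    case: resF => _ hI _ _; have [v ->] := (hI f).1 If.
    by exists v; rewrite [LHS]mx11_scalar.
  have [|W EW] := @adiff_lift 0 _ (f%:M - adiff 0 *m homotopy f 0); last by exists W.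
  by rewrite mulmxBl -mulmxA E0 scalar_mxC subrr.
apply: (epsilon_spec (inhabits 0)
         (fun M => M *m adiff i.+2 = f%:M - adiff i.+1 *m homotopy f i.+1)).
(* The right-hand side is killed by the differential, by the preceding homotopy identity and
   [adiff2], so exactness factors it. *)
have [|W EW] := @adiff_lift i.+1 _ (f%:M - adiff i.+1 *m homotopy f i.+1).
  rewrite mulmxBl -mulmxA [homotopy f i.+1 *m _]IH mulmxBr mulmxA adiff2 mul0mx subr0.
  by rewrite scalar_mxC subrr.
by exists W.
Qed.

End Resolution.

(** By minimality the differentials vanish after tensoring with [k], so every basis vector is a
    cycle but not a boundary: it gives a nonzero Tor class in its degree. *)
Lemma gdeg_bound (k : fieldType) (r p : nat) (F : free_complex k r) i :
  minimal_complex F -> (forall e, (p < e)%N -> Tor_vanishes F i e) ->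
  forall j : 'I_(rk F i), (gdeg j <= p)%N.
Proof.
move=> minF torF j; rewrite leqNgt; apply/negP=> /torF /(_ (delta_mx 0 j)).
case=> [l||w].
- by rewrite mxE eqxx /=; case: (eqVneq l j) => // ->; rewrite eqxx.
- by case: {torF} i j => //= i j; rewrite /cycle_k minF mulmx0.
- rewrite minF mulmx0 => /matrixP/(_ 0 j)/eqP.
  by rewrite !mxE !eqxx oner_eq0.
Qed.

(** * Cancelling the parameter on the linear subspace *)

Section SaturationStep.
Variables (k : fieldType) (r n N : nat) (X : closed_subscheme k r).
Variables (F : free_complex k r.+1) (resF : graded_free_resolution X F).
Hypothesis degF : forall j : 'I_(rk F n), (gdeg j <= n + 2)%N.
Variables (A : 'M[k]_(n.+1, r.+1)) (fA : row_free A).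
Hypothesis N_gt0 : (0 < N)%N.
Let J := inter_ideal A X.
Hypothesis powJ : forall i : 'I_n.+1, exists c, J ('X_i ^+ N - 'X_ord0 * c).

(** The chase starts in degree [e + 1]. Generators at position [n.+1] have degree at most [n + 2],
    so coefficients there have degree at least [e + 1 + n * N - (n + 2)], which exceeds
    [n * (N - 1)] because [2 <= e]. *)
Lemma saturation_step e q :
  (2 <= e)%N -> q \is e.-homog -> J ('X_ord0 * q) -> J q.
Proof.
move=> e2 hq Jq; have idJ : is_ideal J := inter_ideal_ideal X fA.
have hX0 : shomog 0 1 ('X_ord0 : {mpoly k[n.+1]}).
  by rewrite -[1%N]addn0; apply/dhomog_shomog/dhomog_var.
have hXN i : shomog 0 N ('X_i ^+ N : {mpoly k[n.+1]}).
  by rewrite -[N in shomog 0 N]addn0; apply/dhomog_shomog/dhomog_exp/dhomog_var.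
(* As [J] is homogeneous, each [c] can be replaced by its component of degree [N - 1]. *)
have /fin_all_exists[c Jc] i :
    exists c, J ('X_i ^+ N - 'X_ord0 * c) /\ shomog 1 N c.
  have [c Jc] := powJ i; exists (hcomp 1 N c); split; last exact: hcompP.
  rewrite mulrC -(hcompM N _ hX0) -(hcomp_id (hXN i)) -hcompN -hcompD mulrC.
  exact: homogeneous_hcomp (@inter_ideal_homog _ _ _ X A) Jc.
pose f := param N c.
have f_homog a : (a < n)%N -> f a.+1 \is N.-homog.
  move=> an; have [_ hc] := Jc (inord a.+1).
  rewrite -[N]subn0; apply: shomog_dhomog => // m /msuppB_le.
  rewrite mem_cat => /orP[/hXN//|]; rewrite mulrC; exact: (shomogM hc hX0).
(* Lifts of the [f a] with [a > 0] to the ideal of [X]; their homotopies exist over the larger ring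
   and are then restricted. *)
pose fS a := epsilon (inhabits 0) (fun g => X g /\ f a = restr_form A g).
have fSP a : (a < n)%N -> X (fS a.+1) /\ f a.+1 = restr_form A (fS a.+1).
  move=> an; apply: (epsilon_spec (inhabits 0)
    (fun g => X g /\ f a.+1 = restr_form A g)).
  by have [[g Xg Eg] _] := Jc (inord a.+1); exists g.
pose d i := map_mx (restr_form A) (adiff F i).
pose s a i := map_mx (restr_form A) (homotopy F (fS a) i).
have d_homog i j l : shomog (@agdeg _ _ F i l) (@agdeg _ _ F i.+1 j) (d i j l).
  rewrite mxE => m mj; have hd := @adiff_homog _ _ _ _ resF i j l.
  have [lj|jl] := leqP (agdeg l) (agdeg j).
    have /restr_form_homog := shomog_dhomog lj hd.
    by move=> /(_ _ A)/dhomogP/(_ _ mj)/= ->; rewrite subnK.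
  move: mj; suff -> : adiff F i j l = 0 by rewrite raddf0 msupp0.
  apply/mpolyP=> m'; rewrite mcoeff0; apply/eqP; rewrite mcoeff_eq0.
  by apply/negP=> /hd; lia.
have [v Xv Ev] : exists2 g, X g & 'X_ord0 * q = restr_form A g by [].
have [u Eu] : exists u, ('X_ord0 * q)%:M = u *m d 0.
  case: resF => _ hX _ _; have [u0 Eu0] := (hX v).1 Xv.
  exists (map_mx (restr_form A) u0); rewrite -map_mxM /= [u0 *m _]mx11_scalar -Eu0.
  by rewrite map_scalar_mx /= Ev.
have [||||||||||||w Ew] := @chase0 k n.+1 n N (ark F) (@agdeg _ _ F) d d_homog _ f
    (monoideal (expo N)) _ _ _ _ _ _ _ f_homog s _ e.+1 q%:M u.
- by move=> i; rewrite -map_mxM (adiff2 resF) map_mx0.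
- by move=> a; exact: monoideal_ideal.
- exact: monoideal_homog.
- exact: monoideal0.
- exact: monoidealS.
- exact: param_in.
- exact: param_split.
- exact: param_reg.
- move=> a i an; have [XfS ->] := fSP a an.
  by rewrite -!map_mxM -raddfD /= (homotopyP resF) // map_scalar_mx.
- move=> j h; apply: monoideal_top => //.
  by have := degF j; rewrite /agdeg; lia.
- move=> j m; rewrite ord1 scale_scalar_mx mxE mulr1n => mq /=.
  by move/dhomogP: (dhomogM (dhomog_var k ord0) hq) => /(_ _ mq)/= ->; rewrite addn0.
- by rewrite scale_scalar_mx.
(* Lifting the entries of [w] along the restriction exhibits [q] as the image of an element of the
   ideal of [X]. *)
have /fin_all_exists[w' Ew'] j := restr_form_surj (w 0 j) fA.
exists ((\row_j w' j *m augm F) 0 0).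
  by case: resF => _ hX _ _; apply/hX; exists (\row_j w' j).
move/matrixP: Ew => /(_ 0 0); rewrite !mxE mulr1n => ->.
rewrite rmorph_sum; apply: eq_bigr => j _ /=.
by rewrite !mxE -Ew' -rmorphM.
Qed.

End SaturationStep.

(** * Finiteness and homogeneous primes *)

(** From each index, jump to a later one where [f] is minimal among all later values. *)
Lemma nondecreasing_subseq (f : nat -> nat) :
  exists2 phi : nat -> nat, {homo phi : x y / (x < y)%N}
    & {homo f \o phi : x y / (x <= y)%N}.
Proof.
pose P i j := (i < j)%N /\ forall j', (i < j')%N -> (f j <= f j')%N.
have exP i : exists j, P i j.
  suff : forall v j, (i < j)%N -> (f j <= v)%N -> exists j, P i j.
    by move=> /(_ _ i.+1 (leqnn _) (leqnn _)).
  elim=> [|v IH] j ij fj.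
    by exists j; split=> // j' _; move: fj; rewrite leqn0 => /eqP->.
  have [[j' [ij' lt]]|no] := classic (exists j', (i < j')%N /\ (f j' < f j)%N).
    by apply: (IH j') => //; rewrite -ltnS; apply: leq_trans fj.
  exists j; split=> // j' ij'; rewrite leqNgt; apply/negP => lt.
  by apply: no; exists j'.
pose nxt i := epsilon (inhabits 0%N) (P i).
have nxtP i : P i (nxt i) := epsilon_spec (inhabits 0%N) _ (exP i).
(* With [x.+1], even the first term is such a minimum. *)
exists (fun x => iter x.+1 nxt 0%N).
  apply: homo_ltn => [y x z|x]; first exact: ltn_trans.
  by case: (nxtP (iter x.+1 nxt 0%N)).
apply: homo_leq => [x|y x z|x] //=; first exact: leq_trans.
have [_ h] := nxtP (iter x nxt 0%N); apply: h.
have [h1 _] := nxtP (iter x nxt 0%N).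
by have [h2 _] := nxtP (iter x.+1 nxt 0%N); apply: ltn_trans h2.
Qed.

(** Subsequences are taken one coordinate at a time, until no exponent decreases. *)
Lemma dickson n (m : nat -> 'X_{1..n}) :
  exists a b, (a < b)%N /\ (m a <= m b)%MM.
Proof.
suff /(_ n)[phi phi_lt phi_le] c : exists2 phi : nat -> nat, {homo phi : x y / (x < y)%N}
    & forall i : 'I_n, (i < c)%N -> {homo (fun x => m (phi x) i) : x y / (x <= y)%N}.
  exists (phi 0%N), (phi 1%N); split; first exact: phi_lt.
  by apply/mnm_lepP => i; apply: phi_le.
elim: c => [|c [phi phi_lt phi_le]]; first by exists id.
have [cn|nc] := ltnP c n; last first.
  by exists phi => // i _; apply: phi_le; apply: leq_trans nc.
have [psi psi_lt psi_le] := nondecreasing_subseq (fun x => m (phi x) (Ordinal cn)).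
exists (phi \o psi) => [x y /psi_lt/phi_lt//|i].
rewrite ltnS leq_eqVlt => /orP[/eqP ic|ic] x y xy /=.
  by rewrite (_ : i = Ordinal cn); [exact: psi_le | exact: val_inj].
by apply: phi_le => //; move: xy; rewrite leq_eqVlt => /orP[/eqP->|/psi_lt/ltnW].
Qed.

Section Noether.
Variables (k : fieldType) (n : nat).
Local Notation T := {mpoly k[n]}.

(** If every step were strict, choose [g i] new at step [i] with least leading monomial. By Dickson
    some [mlead (g a)] divides [mlead (g b)] with [a < b]; subtracting a multiple of [g a] from
    [g b] lowers the leading monomial, so the difference, and hence [g b], lies in [I b]. *)
Lemma ideal_acc (I : nat -> T -> Prop) :
  (forall i, is_ideal (I i)) -> (forall i h, I i h -> I i.+1 h) ->
  exists i, forall h, I i.+1 h -> I i h.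
Proof.
move=> idI incr; apply: NNPP => no.
pose P i g := [/\ I i.+1 g, ~ I i g
  & forall g', I i.+1 g' -> (mlead g' < mlead g)%O -> I i g'].
have exP i : exists g, P i g.
  have [g [Ig nIg]] : exists g, I i.+1 g /\ ~ I i g.
    apply: NNPP => no'; apply: no; exists i => h Ih.
    by apply: NNPP => nIh; apply: no'; exists h.
  have [m] : exists m, mlead g = m by exists (mlead g).
  elim/(well_founded_ind (@ltom_wf n)): m => m IH in g Ig nIg * => gm.
  have [[g' [Ig' lt nIg']]|no'] :=
    classic (exists g', [/\ I i.+1 g', (mlead g' < mlead g)%O & ~ I i g']).
    by apply: (IH (mlead g')) Ig' nIg' _ => //; rewrite -gm.
  exists g; split=> // g' Ig' lt; apply: NNPP => nIg'.
  by apply: no'; exists g'.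
pose g i := epsilon (inhabits 0) (P i).
have gP i : P i (g i) := epsilon_spec (inhabits 0) _ (exP i).
have [a [b [ab le]]] := dickson (fun i => mlead (g i)).
have [Ia nIa _] := gP a; have [Ib nIb minb] := gP b.
have Iab : I b (g a).
  elim: {minb Ib nIb le} b ab => // b IH; rewrite ltnS leq_eqVlt.
  by move=> /orP[/eqP<-//|/IH/incr].
have ga0 : g a != 0 by apply/eqP => g0; apply: nIa; rewrite g0; apply: ideal0.
have gb0 : g b != 0 by apply/eqP => g0; apply: nIb; rewrite g0; apply: ideal0.
pose c := mleadc (g b) / mleadc (g a).
pose p := c *: 'X_[mlead (g b) - mlead (g a)] * g a.
have Ip : I b p by apply: idealMl.
apply: nIb; rewrite -(subrK p (g b)); apply: idealD => //.
have [->|h0] := eqVneq (g b - p) 0; first exact: ideal0.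
apply: minb; first by apply: idealB => //; apply: incr.
have c0 : c != 0 by rewrite mulf_neq0 ?invr_eq0 ?mleadc_eq0.
have lp : mlead p = mlead (g b).
  by rewrite /p -scalerAl mleadZ // mleadM // ?mleadXm ?submK // -msupp_eq0 msuppX.
rewrite lt_neqAle; apply/andP; split; last first.
  by rewrite (le_trans (mleadB_le _ _)) // lp leUx lexx.
apply: contraNneq h0 => e.
rewrite -mleadc_eq0 e mcoeffB -{2}(submK le) /p -scalerAl mcoeffZ.
by rewrite (mulrC 'X_[_]) mcoeffMX /c divfK ?subrr ?mleadc_eq0.
Qed.


(** A counterexample would start a strictly increasing chain of counterexamples, against
    [ideal_acc]. *)
Lemma noetherian_ind (Phi : (T -> Prop) -> Prop) :
  (forall K, is_ideal K -> homogeneous K ->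
    (forall K' : T -> Prop, is_ideal K' -> homogeneous K' ->
       (forall h, K h -> K' h) -> (exists h, K' h /\ ~ K h) -> Phi K') ->
    Phi K) ->
  forall K, is_ideal K -> homogeneous K -> Phi K.
Proof.
move=> step K0 idK0 hK0; apply: NNPP => nPhi0.
pose bad K := [/\ is_ideal K, homogeneous K & ~ Phi K].
pose R K K' := [/\ bad K', forall h, K h -> K' h & exists h, K' h /\ ~ K h].
pose nxt K := epsilon (inhabits K) (R K).
have nxtP K : bad K -> R K (nxt K).
  case=> idK hK nPhi; apply: (epsilon_spec (inhabits K) (R K)).
  apply: NNPP => no; apply/nPhi/step => // K' idK' hK' sub lt.
  by apply: NNPP => nPhi'; apply: no; exists K'.
pose I i := iter i nxt K0.
have badI i : bad (I i) by elim: i => [//|i /nxtP[]].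
have [||i le] := @ideal_acc I.
- by move=> i; case: (badI i).
- by move=> i h; case: (nxtP _ (badI i)) => _ + _; apply.
by case: (nxtP _ (badI i)) => _ _ [h [/le]].
Qed.

(** The ideal [K + (f)]. *)
Definition adjoin (K : T -> Prop) (f h : T) := exists a, K (h - a * f).

Lemma adjoin_ideal K f : is_ideal K -> is_ideal (adjoin K f).
Proof.
move=> idK; split.
- by exists 0; rewrite mul0r subr0; apply: ideal0.
- move=> g h [a Ka] [b Kb]; exists (a + b).
  by rewrite mulrDl opprD addrACA; apply: idealD.
- move=> c h [a Ka]; exists (c * a).
  by rewrite -mulrA -mulrBr; apply: idealMl.
Qed.

Lemma adjoin_homog K f d :
  is_ideal K -> homogeneous K -> f \is d.-homog -> homogeneous (adjoin K f).
Proof.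
move=> idK hK hf h [a Ka] e; exists (hcomp d e a).
have hf' : shomog 0 d f by rewrite -[d]addn0; apply: dhomog_shomog.
rewrite -(hcompM e a hf') pihomog_hcomp -hcompN -hcompD.
exact: homogeneous_hcomp Ka.
Qed.

Lemma adjoin_sub (K : T -> Prop) f h : K h -> adjoin K f h.
Proof. by move=> Kh; exists 0; rewrite mul0r subr0. Qed.

Lemma adjoin_mem K f : is_ideal K -> adjoin K f f.
Proof. by move=> idK; exists 1; rewrite mul1r subrr; apply: ideal0. Qed.

Lemma pihomogM_top a b (f g : T) :
  (forall m, m \in msupp f -> (mdeg m < a.+1)%N) ->
  (forall m, m \in msupp g -> (mdeg m < b.+1)%N) ->
  pihomog mdeg (a + b) (f * g) = pihomog mdeg a f * pihomog mdeg b g.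
Proof.
move=> hf hg; set F := pihomog mdeg a f; set G := pihomog mdeg b g.
have -> : f * g = F * G + (F * (g - G) + (f - F) * g).
  by rewrite mulrBr mulrBl addrA [F * G + _]addrC subrK addrC subrK.
rewrite raddfD /= pihomog_dE; last by apply: dhomogM; apply: pihomogP.
suff -> : pihomog mdeg (a + b) (F * (g - G) + (f - F) * g) = 0 by rewrite addr0.
apply/mpolyP=> m; rewrite mcoeff_pihomog mcoeff0; case: eqP => // dm.
apply/eqP; rewrite mcoeff_eq0; apply/negP => /msuppD_le; rewrite mem_cat.
case/orP=> /msuppM_le/allpairsP[[m1 m2] /= [+ + mE]]; rewrite mE mdegD in dm.
- move=> /(dhomogP _ _ _ (pihomogP mdeg a f)) /= d1.
  rewrite mcoeff_msupp mcoeffB mcoeff_pihomog.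
  have -> : mdeg m2 = b by lia.
  by rewrite eqxx subrr eqxx.
- rewrite !mcoeff_msupp mcoeffB mcoeff_pihomog => h1.
  rewrite -mcoeff_msupp => /hg; move: h1; case: (mdeg m1 =P a) => [_|ne].
    by rewrite subrr eqxx.
  by rewrite subr0 -mcoeff_msupp => /hf; lia.
Qed.

(** Induction on the sum of the degree bounds. The product of the top components is a component of
    [f * g], hence in [K]; so one top component is in [K] and can be subtracted. *)
Lemma homogeneous_prime K : is_ideal K -> homogeneous K -> ~ K 1 ->
  (forall d e (f g : T), f \is d.-homog -> g \is e.-homog -> K (f * g) -> K f \/ K g) ->
  is_prime K.
Proof.
move=> idK hK K1 hP; split=> // f g.
have bnd (h : T) : exists a, forall m, m \in msupp h -> (mdeg m < a)%N.
  by exists (msize h) => m; apply: msize_mdeg_lt.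
have [a hf] := bnd f; have [b hg] := bnd g.
have bnd0 (h : T) : (forall m, m \in msupp h -> (mdeg m < 0)%N) -> K h.
  move=> h0; suff -> : h = 0 by apply: ideal0.
  apply/mpolyP=> m; rewrite mcoeff0; apply/eqP; rewrite mcoeff_eq0.
  by apply/negP => /h0.
have bndB c (h : T) : (forall m, m \in msupp h -> (mdeg m < c.+1)%N) ->
    forall m, m \in msupp (h - pihomog mdeg c h) -> (mdeg m < c)%N.
  move=> hh m; rewrite mcoeff_msupp mcoeffB mcoeff_pihomog.
  case: (mdeg m =P c) => [_|ne]; first by rewrite subrr eqxx.
  by rewrite subr0 -mcoeff_msupp => /hh; lia.
have [s] := ubnP (a + b)%N; elim: s => // s IH in a b f g hf hg *.
case: a hf => [/bnd0|a hf]; first by left.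
case: b hg => [/bnd0|b hg]; first by right.
move=> ab Kfg; have := hK _ Kfg (a + b)%N; rewrite pihomogM_top //.
move=> /(hP _ _ _ _ (pihomogP _ _ _) (pihomogP _ _ _))[KF|KG].
  have [||||KF'|] := IH a b.+1 (f - pihomog mdeg a f) g; try by [|right].
  - exact: bndB.
  - by rewrite mulrBl; apply: idealB => //; rewrite mulrC; apply: idealMl.
  by left; rewrite -(subrK (pihomog mdeg a f) f); apply: idealD.
have [||||KF'|KG'] := IH a.+1 b f (g - pihomog mdeg b g); try by [|left].
- exact: bndB.
- by move: ab; rewrite addSn addnS ltnS.
- by rewrite mulrBr; apply: idealB => //; apply: idealMl.
by right; rewrite -(subrK (pihomog mdeg b g) g); apply: idealD.
Qed.

(** Products of one element from each member of [Ps] and an arbitrary factor. Sums are left out,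
    since only containment in ideals is tested. *)
Fixpoint prod_in (Ps : seq (T -> Prop)) (h : T) : Prop :=
  if Ps is P :: Ps' then exists g h', [/\ P g, prod_in Ps' h' & h = g * h'] else True.

Lemma prod_in_cat Ps Qs h : prod_in (Ps ++ Qs) h ->
  exists h1 h2, [/\ prod_in Ps h1, prod_in Qs h2 & h = h1 * h2].
Proof.
elim: Ps h => [|P Ps IH] h /=; first by exists 1, h; rewrite mul1r.
case=> g [h' [Pg /IH[h1 [h2 [P1 P2 ->]]] ->]].
by exists (g * h1), h2; split; rewrite ?mulrA //; exists g, h1.
Qed.

(** If a proper [K] is not prime, some homogeneous [f] and [g] outside [K] have product in [K]; then
    [K + (f)] times [K + (g)] lies in [K], and the two lists of primes are concatenated. *)
Lemma prime_product K : is_ideal K -> homogeneous K ->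
  exists Ps : seq (T -> Prop),
    (forall P, List.In P Ps -> [/\ is_prime P, homogeneous P & forall h, K h -> P h])
    /\ forall h, prod_in Ps h -> K h.
Proof.
move: K; apply: noetherian_ind => K idK hK IH.
have [K1|K1] := classic (K 1).
  by exists [::]; split=> // h _; rewrite -[h]mulr1; apply: idealMl.
have [prK|nprK] := classic (is_prime K).
  exists [:: K]; split=> [P [<-|]|h [g [h' [Kg _ ->]]]] //.
  by rewrite mulrC; apply: idealMl.
have [d [e [f [g [hf hg Kfg nKf nKg]]]]] : exists d e (f g : T),
    [/\ f \is d.-homog, g \is e.-homog, K (f * g), ~ K f & ~ K g].
  apply: NNPP => no; apply/nprK/homogeneous_prime => // d e f g hf hg Kfg.
  have [Kf|nKf] := classic (K f); first by left.
  by right; apply: NNPP => nKg; apply: no; exists d, e, f, g.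
have [||||Ps [PsP PsK]] := IH (adjoin K f).
- exact: adjoin_ideal.
- exact: adjoin_homog hf.
- by move=> h; apply: adjoin_sub.
- by exists f; split=> //; apply: adjoin_mem.
have [||||Qs [QsP QsK]] := IH (adjoin K g).
- exact: adjoin_ideal.
- exact: adjoin_homog hg.
- by move=> h; apply: adjoin_sub.
- by exists g; split=> //; apply: adjoin_mem.
exists (Ps ++ Qs); split=> [P /(@List.in_app_or _ _ _ _)[/PsP|/QsP] [prP hP sub]|h].
- by split=> // h Kh; apply/sub/adjoin_sub.
- by split=> // h Kh; apply/sub/adjoin_sub.
case/prod_in_cat=> h1 [h2 [/PsK[c Kc] /QsK[c' Kc'] ->]].
rewrite -(subrK (c * f) h1) mulrDl; apply: idealD => //.
  by rewrite mulrC; apply: idealMl.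
rewrite -(subrK (c' * g) h2) mulrDr; apply: idealD => //; first exact: idealMl.
by rewrite mulrACA; apply: idealMl.
Qed.

Lemma prime_prod_sub P Ps : is_prime P -> (forall h, prod_in Ps h -> P h) ->
  exists2 P', List.In P' Ps & forall h, P' h -> P h.
Proof.
case=> _ P1 prP; elim: Ps => [|P' Ps IH] sub; first by case: P1; apply: sub.
have [?|] := classic (forall h, P' h -> P h); first by exists P' => //; left.
case/not_all_ex_not => g ng; have [P'g nPg] := imply_to_and _ _ ng.
have [h Ph|P'' inP'' ?] := IH; last by exists P'' => //; right.
by case: (prP g h) => //; apply: sub; exists g, h.
Qed.

(** The primes whose product lies in [K] contain all variables, so a monomial with at least as many
    factors as there are primes is such a product. *)
Lemma irrelevant_power (K : T -> Prop) : is_ideal K -> homogeneous K ->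
  (forall P : T -> Prop, is_prime P -> homogeneous P -> (forall h, K h -> P h) ->
     forall i, P 'X_i) ->
  exists N, forall m, (N <= mdeg m)%N -> K 'X_[m].
Proof.
move=> idK hK irr; have [Ps [PsP PsK]] := prime_product idK hK.
exists (size Ps) => m lm; apply: PsK.
have {}PsP P : List.In P Ps -> forall i, P 'X_i by case/PsP => prP hP sub i; apply: irr.
elim: Ps PsP m lm => //= P Ps IH PsP m lm.
have [i mi] : exists i, (0 < m i)%N.
  apply: NNPP => no; move: lm; rewrite mdegE big1 // => i _.
  by apply/eqP; rewrite -leqn0 leqNgt; apply/negP => mi; apply: no; exists i.
have Em : m = (U_(i) + (m - U_(i)))%MM.
  rewrite addmC submK //; apply/mnm_lepP => j; rewrite mnm1E.
  by case: eqP => // <-.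
exists 'X_i, 'X_[m - U_(i)]; split; last by rewrite -mpolyXD -Em.
- by apply: PsP; left.
- apply: IH => [Q inQ|]; first by apply: PsP; right.
  by move: lm; rewrite {1}Em mdegD mdeg1.
Qed.

End Noether.

(** Euclid's argument: a root of [p] cannot lie in [s]. For empty [s], [p] is constant and a root
    need not exist. *)
Lemma closed_field_infinite (k : closedFieldType) (s : seq k) : exists c, c \notin s.
Proof.
pose p := \prod_(b <- s) ('X - b%:P) + 1 : {poly k}.
have [s0|s0] := posnP (size s); first by exists 0; rewrite (size0nil s0).
have sp : size p != 1%N.
  by rewrite size_polyDl size_prod_XsubC ?size_polyC ?oner_eq0 // eqSS -lt0n.
have /closed_rootP[c] := sp; rewrite /root /p hornerD hornerC => rc.
exists c; apply/negP => cs; move: rc.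
have /rootP-> : root (\prod_(b <- s) ('X - b%:P)) c by rewrite root_prod_XsubC.
by rewrite add0r oner_eq0.
Qed.

(** * Linear forms avoiding finitely many primes *)

Section Avoidance.
Variables (k : closedFieldType) (n : nat).
Local Notation T := {mpoly k[n.+1]}.
Implicit Types (P : T -> Prop) (Ps : seq (T -> Prop)).

(** Each ideal meets the line [u + c *: v] for at most one [c]: two values would put [v], and then
    [u], in it. *)
Lemma line_avoidance Ps (u v : T) :
  (forall P, List.In P Ps -> is_ideal P /\ ~ (P u /\ P v)) ->
  exists s : seq k, forall c, c \notin s -> forall P, List.In P Ps -> ~ P (u + c *: v).
Proof.
elim: Ps => [|P Ps IH] idPs; first by exists [::] => c _ P [].
have [P' inP'|s hs] := IH; first by apply: idPs; right.
have [idP nP] := idPs P (or_introl erefl).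
have [[c0 Pc0]|no] := classic (exists c0, P (u + c0 *: v)); last first.
  exists s => c cs P' [<-|]; last exact: hs.
  by move=> Pc; apply: no; exists c.
exists (c0 :: s) => c; rewrite inE negb_or => /andP[cc0 cs] P' [<-|]; last exact: hs.
move=> Pc; have Pv : P v.
  have : P ((c - c0)^-1%:MP * ((u + c *: v) - (u + c0 *: v))).
    by apply: idealMl => //; apply: idealB.
  rewrite opprD addrACA subrr add0r -scalerBl mul_mpolyC scalerA mulVf ?scale1r //.
  by rewrite subr_eq0.
apply: nP; split=> //; rewrite -(addrK (c *: v) u); apply: idealB => //.
by rewrite -mul_mpolyC; apply: idealMl.
Qed.

Definition linform (a : 'cV[k]_n.+1) : T := \sum_i a i 0 *: 'X_i.

Lemma linform_avoidance Ps :
  (forall P, List.In P Ps -> is_ideal P /\ exists i, ~ P 'X_i) ->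
  exists a, forall P, List.In P Ps -> ~ P (linform a).
Proof.
elim: Ps => [|P Ps IH] idPs; first by exists 0 => P [].
have [P' inP'|a ha] := IH; first by apply: idPs; right.
have [idP [i nPi]] := idPs P (or_introl erefl).
(* On the line through [linform a] in direction ['X_i], the direction is outside [P] and the base
   point outside every member of [Ps]. *)
have [s hs] : exists s : seq k, forall c, c \notin s ->
    forall P', List.In P' (P :: Ps) -> ~ P' (linform a + c *: 'X_i).
  have [Pa|nPa] := classic (P (linform a)).
    apply: line_avoidance => P' [<-|inP']; first by split=> // -[].
    split; last by case=> /(ha _ inP').
    by case: (idPs P') => //; right.
  have [P' inP'|s hs] := @line_avoidance (P :: Ps) (linform a) 'X_i.
    case: (idPs P' inP') => idP' _; split=> // -[Pu _].
    by case: inP' Pu => [<-//|/ha].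
  by exists s.
have [c /hs hc] := closed_field_infinite s.
exists (a + c *: delta_mx i 0) => P' /hc.
suff -> : linform (a + c *: delta_mx i 0) = linform a + c *: 'X_i by [].
rewrite /linform; under eq_bigr do rewrite !mxE scalerDl eqxx andbT.
rewrite big_split /=; congr (_ + _).
rewrite (bigD1 i) //= eqxx mulr1 big1 ?addr0 // => j ji.
by rewrite (negPf ji) mulr0 scale0r.
Qed.

Lemma linform_homog a : linform a \is 1.-homog.
Proof. by apply: rpred_sum => i _; apply/rpredZ/dhomog_var. Qed.

(* A form outside all the (finitely many) relevant primes over which [J] is a
   product is a parameter: a relevant prime containing it strictly contains one
   of those. *)
Lemma linear_parameter (J : T -> Prop) : is_ideal J -> homogeneous J ->
  proj_dim_eq J 0 ->
  exists a, linform a != 0 /\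
    exists N, forall m, (N <= mdeg m)%N -> adjoin J (linform a) 'X_[m].
Proof.
move=> idJ hJ [[C [/(_ 0 isT) [prP0 hP0 JP0 relP0] _]] ndim].
set P0 := C 0%N in prP0 hP0 JP0 relP0.
have [Ps [PsP PsJ]] := prime_product idJ hJ.
(* The relevant primes among [P0] and the factors. Including [P0] ensures that a form avoiding them
   is nonzero. *)
have [Rs RsP] : exists Rs, forall P, List.In P Rs <->
    (List.In P (P0 :: Ps) /\ exists i, ~ P 'X_i).
  elim: (P0 :: Ps) => [|P Qs [Rs RsE]]; first by exists [::]; intuition.
  have [rel|nrel] := classic (exists i, ~ P 'X_i).
    exists (P :: Rs) => P' /=; rewrite RsE.
    by split=> [[<-|[]]|[[<-|] ?]]; intuition.
  exists Rs => P' /=; rewrite RsE.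
  by split=> [[]|[[<-|] ?]]; intuition.
have [P /RsP[inP rel]|a ha] := @linform_avoidance Rs.
  split=> //; case: inP => [<-|/PsP[[]]] //; by case: prP0.
exists a; split.
  apply/eqP => a0; case: (ha P0); first by apply/RsP; split=> //; left.
  by rewrite a0; apply: ideal0; case: prP0.
apply: irrelevant_power => [||P prP hP sub i].
- exact: adjoin_ideal.
- exact: adjoin_homog (linform_homog a).
apply: NNPP => nPi; apply: ndim.
have JP h : J h -> P h by move=> Jh; apply/sub/adjoin_sub.
have [P' inP' P'P] : exists2 P', List.In P' Ps & forall h, P' h -> P h.
  by apply: prime_prod_sub => // h /PsJ/JP.
have [prP' hP' JP'] := PsP _ inP'.
have nPi' : ~ P' 'X_i by move=> /P'P.
exists (fun c => if c is 0 then P' else P); split=> [[|c] _|[|c]] //.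
- by split=> //; exists i.
- by split=> //; exists i.
move=> _; split=> //; exists (linform a); split; first exact/sub/adjoin_mem.
by apply: ha; apply/RsP; split; [right | exists i].
Qed.

End Avoidance.

(** * Saturation in degree two *)

(** In the rank normal form of the column [a] the right factor is a scalar [c], so [a] is [c] times
    the first column of [col_ebase a]. *)
Lemma unitmx_with_col (k : fieldType) n (a : 'cV[k]_n.+1) : a != 0 ->
  exists2 D : 'M[k]_n.+1, D \in unitmx & col 0 D = a.
Proof.
move=> a0; have ra : \rank a = 1%N.
  by apply/eqP; rewrite eqn_leq rank_leq_col lt0n mxrank_eq0.
have [c Ec] : exists c, row_ebase a = c%:M by exists (row_ebase a 0 0); apply: mx11_scalar.
have c0 : c \is a GRing.unit.
  by have := row_ebase_unit a; rewrite Ec unitmxE det_scalar expr1.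
exists (c *: col_ebase a); first by rewrite unitmxZ // col_ebase_unit.
rewrite -[RHS]mulmx_ebase Ec ra mul_mx_scalar linearZ /= colE.
congr (c *: (_ *m _)); apply/matrixP => i j; rewrite !mxE !ord1.
by rewrite -val_eqE /= andbT; case: eqP => // ->.
Qed.

Lemma homog_in_power (k : fieldType) n (K : {mpoly k[n]} -> Prop) N d h :
  is_ideal K -> (forall m, (N <= mdeg m)%N -> K 'X_[m]) ->
  h \is d.-homog -> (N <= d)%N -> K h.
Proof.
move=> idK KN /dhomogP hh Nd; rewrite (mpolyE h) big_seq.
apply: ideal_sum => // m /hh /= dm; rewrite -mul_mpolyC; apply: idealMl => //.
by apply: KN; rewrite dm.
Qed.

Section Main.
Variables (k : closedFieldType) (r p : nat) (hp : (1 <= p)%N).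
Variables (X : closed_subscheme k r) (hX : N2 p X).
Variables (n : nat) (hn : (n <= p - 1)%N).
Variables (A : 'M[k]_(n.+1, r.+1)) (hA : row_free A).
Hypothesis hdim : proj_dim_eq (inter_ideal A X) 0.
Let J := inter_ideal A X.

Lemma quadric_saturation q N : q \is 2.-homog ->
  (forall m, (N <= mdeg m)%N -> J ('X_[m] * q)) -> J q.
Proof.
move=> hq Jq; have idJ := inter_ideal_ideal X hA.
have [a [l0 [M powM]]] := linear_parameter idJ (@inter_ideal_homog _ _ _ X A) hdim.
have [D uD Da] : exists2 D : 'M[k]_n.+1, D \in unitmx & col 0 D = a.
  apply: unitmx_with_col; apply: contraNneq l0 => ->.
  by rewrite /linform big1 // => i _; rewrite mxE scale0r.
have DX0 : restr_form D 'X_ord0 = linform a.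
  by rewrite restr_formX -Da; apply: eq_bigr => i _; rewrite mxE.
(* Substitution by [C] turns [linform a] into ['X_ord0]; [J'] is [J] in the new coordinates. *)
pose C := invmx D; pose J' := inter_ideal (C *m A) X.
have CD f : restr_form C (restr_form D f) = f.
  by rewrite -restr_formM mulVmx // restr_form1.
have DC f : restr_form D (restr_form C f) = f.
  by rewrite -restr_formM mulmxV // restr_form1.
have JJ' h : J h -> J' (restr_form C h) by apply: inter_idealM.
have J'J h : J' h -> J (restr_form D h).
  by move/(inter_idealM D); rewrite mulmxA mulmxV // mul1mx.
have fCA : row_free (C *m A).
  have /row_freeP[B AB] := hA; apply/row_freeP; exists (B *m D).
  by rewrite mulmxA -(mulmxA C) AB mulmx1 mulVmx.
case: hX => _ _ [F [resF minF torF]].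
(* Here [n < p], so the linear part of the resolution reaches [F_n]. *)
have degF : forall j : 'I_(rk F n), (gdeg j <= n + 2)%N.
  apply: gdeg_bound => // e; apply: torF.
  by rewrite -(subnK hp) addn1 ltnS.
have powJ' (i : 'I_n.+1) : exists c, J' ('X_i ^+ M.+1 - 'X_ord0 * c).
  have [c Jc] : adjoin J (linform a) (restr_form D ('X_i ^+ M.+1)).
    apply: (@homog_in_power _ _ _ M M.+1) => //; first exact: adjoin_ideal.
    exact/restr_form_homog/dhomog_exp/dhomog_var.
  exists (restr_form C c); have := JJ' _ Jc.
  by rewrite rmorphB rmorphM /= CD -DX0 CD mulrC.
pose q' := restr_form C q.
have hq' : q' \is 2.-homog by apply: restr_form_homog.
have step := saturation_step resF degF fCA (ltn0Sn M) powJ'.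
(* Powers of ['X_ord0] are removed one at a time, from forms of degree [i + 2]. *)
have sat i : J' ('X_ord0 ^+ i * q') -> J' q'.
  elim: i => [|i IH]; rewrite ?expr0 ?mul1r // exprS -mulrA => Ji.
  apply: IH; apply: (step (i + 2)%N _ _ _ Ji); first by rewrite addn2.
  by apply: dhomogM => //; apply/dhomog_exp/dhomog_var.
rewrite -[q]DC; apply: J'J; apply: (sat N).
have -> : 'X_ord0 ^+ N * q' = restr_form C (linform a ^+ N * q).
  by rewrite rmorphM rmorphXn /= -DX0 CD.
(* The [h] with [h * q] in [J] form an ideal containing all monomials of degree at least [N], hence
   [linform a ^+ N]. *)
apply: JJ'; apply: (@homog_in_power _ _ (fun h => J (h * q)) N N) => //.
- split=> [|f g Jf Jg|b f Jf].
  + by rewrite mul0r; apply: ideal0.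
  + by rewrite mulrDl; apply: idealD.
  + by rewrite -mulrA; apply: idealMl.
- exact/dhomog_exp/linform_homog.
Qed.

End Main.

(** Comparing charts shows that ['X_ord0 ^+ e ord0] divides its numerator, so the section is a form
    [q]. Each chart then provides a power of its variable that multiplies [q] into [J]. *)
Lemma H0_quadric (k : fieldType) n (J : {mpoly k[n.+1]} -> Prop) t :
  is_ideal J -> H0 J 2 t ->
  exists q, [/\ q \is 2.-homog, t = tofrac q
    & exists N, forall m, (N <= mdeg m)%N -> J ('X_[m] * q)].
Proof.
move=> idJ Ht.
have X0 (i : 'I_n.+1) e : tofrac ('X_i ^+ e : {mpoly k[n.+1]}) != 0.
  by rewrite tofrac_eq0 mpolyXn -msupp_eq0 msuppX.
have /fin_all_exists[e /fin_all_exists[g Hg]] := Ht.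
have Eg i : t * tofrac ('X_i ^+ e i) = tofrac (g i).
  by case: (Hg i) => _ _ <-; rewrite rmorphXn.
have div0 m : m \in msupp (g ord0) -> (e ord0 <= m ord0)%N.
  move=> mg; have [_ /dhomogP/(_ _ mg)/= dm _] := Hg ord0.
  have [/existsP[i i0]|] := boolP [exists i : 'I_n.+1, i != ord0].
    have Ei : g ord0 * 'X_[U_(i) *+ e i] = g i * 'X_[U_(ord0) *+ e ord0].
      apply/eqP; rewrite -tofrac_eq; apply/eqP; rewrite -!mpolyXn !rmorphM /= -!Eg.
      by rewrite mulrAC.
    have : (U_(i) *+ e i + m)%MM \in msupp (g i * 'X_[U_(ord0) *+ e ord0]).
      by rewrite -Ei mcoeff_msupp mcoeffMX -mcoeff_msupp.
    case/msuppM_le/allpairsP=> -[m1 m2] /= [_]; rewrite msuppX inE => /eqP-> /mnmP/(_ ord0).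
    rewrite !mnmDE !mulmnE !mnm1E eqxx (negPf i0) mul0n mul1n add0n => ->.
    exact: leq_addl.
  (* With [ord0] the only variable, the exponent is the whole degree [2 + e ord0]. *)
  rewrite negb_exists => /forallP h; have -> : m ord0 = mdeg m.
    rewrite mdegE (bigD1 ord0) //= big1 ?addn0 // => i i0.
    by move: (h i); rewrite i0.
  by rewrite dm leq_addl.
pose q : {mpoly k[n.+1]} :=
  \sum_(m <- msupp (g ord0)) (g ord0)@_m *: 'X_[m - U_(ord0) *+ e ord0].
have Eq : g ord0 = q * 'X_ord0 ^+ e ord0.
  rewrite {1}(mpolyE (g ord0)) mulr_suml big_seq [RHS]big_seq.
  apply: eq_bigr => m /div0 em; rewrite -scalerAl mpolyXn -mpolyXD submK //.
  apply/mnm_lepP=> i; rewrite mulmnE mnm1E; case: eqP => [<-|]; last by rewrite mul0n.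
  by rewrite mul1n.
have tq : t = tofrac q.
  by apply: (mulIf (X0 ord0 (e ord0))); rewrite Eg Eq rmorphM.
exists q; split=> //.
  rewrite /q big_seq; apply: rpred_sum => m mg; apply: rpredZ.
  rewrite dhomogX /=; have [_ /dhomogP/(_ _ mg)/= dm _] := Hg ord0.
  have le : (U_(ord0) *+ e ord0 <= m)%MM.
    apply/mnm_lepP=> i; rewrite mulmnE mnm1E; case: eqP => [<-|]; last by rewrite mul0n.
    by rewrite mul1n div0.
  move: dm; rewrite -{1}(submK le) mdegD mdegMn mdeg1 mul1n.
  by move/eqP; rewrite eqn_add2r.
have Jq i : J (q * 'X_i ^+ e i).
  suff -> : q * 'X_i ^+ e i = g i by case: (Hg i).
  by apply/eqP; rewrite -tofrac_eq; apply/eqP; rewrite rmorphM /= -tq Eg.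
(* Beyond this degree, some exponent of [m] reaches the corresponding [e i]. *)
exists (\sum_i e i).+1 => m; rewrite mdegE => lt.
have [i ei] : exists i, (e i <= m i)%N.
  apply: NNPP => no; move: lt; rewrite ltnNge leq_sum // => i _.
  by apply/ltnW; rewrite ltnNge; apply/negP => ei; apply: no; exists i.
have le : (U_(i) *+ e i <= m)%MM.
  apply/mnm_lepP=> j; rewrite mulmnE mnm1E; case: eqP => [<-|]; last by rewrite mul0n.
  by rewrite mul1n.
by rewrite -(submK le) mpolyXD -mpolyXn -mulrA ['X_i ^+ _ * q]mulrC; apply: idealMl.
Qed.

Theorem theorem1p2 (k : closedFieldType) (r p : nat) (hp : (1 <= p)%N)
    (X : closed_subscheme k r) (hX : N2 p X)
    (n : nat) (hn : (n <= p - 1)%N)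
    (A : 'M[k]_(n.+1, r.+1)) (hA : row_free A)
    (hdim : proj_dim_eq (inter_ideal A X) 0) :
  forall t : {fraction {mpoly k[n.+1]}}, H0 (inter_ideal A X) 2 t ->
  exists2 s : {fraction {mpoly k[r.+1]}}, H0 X 2 s & restricts_to A s t.
Proof.
move=> t Ht.
have [q [hq -> [N satq]]] := H0_quadric (inter_ideal_ideal X hA) Ht.
have [f Xf Ef] := quadric_saturation hp hX hn hA hdim hq satq.
(* [f] may have other components, but restriction is graded, so its quadratic part also restricts to
   [q]. *)
have Ef2 : q = restr_form A (pihomog mdeg 2 f).
  by rewrite -pihomog_restr_form -Ef pihomog_dE.
exists (tofrac (pihomog mdeg 2 f)) => [i|i m g Eg].
  exists 0%N, (pihomog mdeg 2 f); split; last by rewrite mulr1.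
  - exact: ideal_of_homogeneous.
  - exact: pihomogP.
(* Any representation of this polynomial as [g / 'X_i ^+ m] has [g] equal to its product with
   ['X_i ^+ m]. *)
have /eqP : tofrac (pihomog mdeg 2 f * 'X_i ^+ m) = tofrac g.
  by rewrite rmorphM rmorphXn.
rewrite tofrac_eq => /eqP <-.
by rewrite rmorphM !rmorphXn /= Ef2 rmorphM /= rmorphXn.
Qed.
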